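(* Let $\chi_1,\chi_2$ be primitive nontrivial Dirichlet characters modulo $q_1,q_2$ respectively, with $\chi_1\chi_2(-1)=1$. There exists a constant $Q=Q(\chi_1,\chi_2)$, depending only on $\chi_1,\chi_2$, such that for all integers $a,c$ with $c\ge1$, $q_1q_2\mid c$ and $\gcd(a,c)=1$, setting $c'=\frac{c}{q_2}$, we have $$|S_{\chi_1,\chi_2}(a,c)|\le Q\cdot D(a,c')\,\log^2 c',$$ where $D(a,c')$ is the largest partial quotient of the continued fraction expansion of $\frac{a}{c'}$.
   Context: For integers $a,c$ with $c\ge 1$, $\gcd(a,c)=1$ and $q_1q_2\mid c$, the newform Dedekind sum is $$S_{\chi_1,\chi_2}(a,c)=\sum_{j \bmod c}\ \sum_{n \bmod q_1}\overline{\chi_2}(j)\,\overline{\chi_1}(n)\,B_1\!\left(\frac{j}{c}\right)B_1\!\left(\frac{n}{q_1}+\frac{aj}{c}\right),$$ where $B_1(x)=x-\lfloor x\rfloor-\frac12$ if $x\in\mathbb{R}\setminus\mathbb{Z}$ and $B_1(x)=0$ if $x\in\mathbb{Z}$. For a non-integral rational number $\frac{a}{b}$ with $b\ge1$, $\gcd(a,b)=1$, write its simple finite continued fraction as $\frac ab=[a_0;a_1,\dots,a_n]=a_0+\cfrac{1}{a_1+\cfrac{1}{\ddots+\cfrac1{a_n}}}$ with $a_0\in\mathbb{Z}$, $n\ge1$, $a_i\in\mathbb{Z}^+$ for $i\ge1$, normalized so that $a_n\ge2$. The partial quotients are $a_1,\dots,a_n$ (excluding $a_0$), and $D(a,b)=\max\{a_i:1\le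 i\le n\}$. Here $\log^2 c'=(\log c')^2$. *)

(* Defs.v *)
From mathcomp Require Import all_boot all_order all_algebra.
From mathcomp Require Import complex.
From mathcomp Require Import all_classical all_reals all_analysis.

Set Implicit Arguments.
Unset Strict Implicit.
Unset Printing Implicit Defensive.

Import Order.TTheory GRing.Theory Num.Theory.

Local Open Scope ring_scope.

(* For [q > 0]; the value [chi 1 = 1] follows from the last two fields. *)
Record dirichlet_character (R : realType) (q : nat) := DirichletCharacter {
  dchar_fun :> int -> R[i];
  dchar_periodic : forall m n : int,
    (m = n %[mod q%:Z])%Z -> dchar_fun m = dchar_fun n;
  dcharM : forall m n : int, dchar_fun (m * n) = dchar_fun m * dchar_fun n;
  dchar_neq0 : forall n : int, (dchar_fun n != 0) = coprimez n q%:Z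
}.

Definition nontrivial_char (R : realType) (q : nat)
    (chi : dirichlet_character R q) : Prop :=
  exists n : int, coprimez n q%:Z /\ chi n <> 1.

Definition induced_from (R : realType) (q d : nat)
    (chi : dirichlet_character R q) (psi : dirichlet_character R d) : Prop :=
  forall n : int, coprimez n q%:Z -> chi n = psi n.

Definition primitive_char (R : realType) (q : nat)
    (chi : dirichlet_character R q) : Prop :=
  forall d : nat, (d %| q)%N -> (d < q)%N ->
  forall psi : dirichlet_character R d, ~ induced_from chi psi.

Definition B1 (R : realType) (x : R) : R :=
  if x \is a Num.int then 0 else x - (Num.floor x)%:~R - 2^-1.

Definition newform_dedekind_sum (R : realType) (q1 q2 : nat)
    (chi1 : dirichlet_character R q1) (chi2 : dirichlet_character R q2)
    (a : int) (c : nat) : R[i] :=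
  \sum_(j < c) \sum_(n < q1)
    (chi2 j%:Z)^* * (chi1 n%:Z)^*
    * (B1 (j%:R / c%:R : R))%:C%C
    * (B1 (n%:R / q1%:R + a%:~R * j%:R / c%:R : R))%:C%C.

Fixpoint cfrac (a0 : rat) (s : seq nat) : rat :=
  if s is a1 :: s' then a0 + (cfrac a1%:R s')^-1 else a0.

(* [x = [a0; a1, ..., an]] with [s = [:: a1; ...; an]]. *)
Definition is_cf_expansion (x : rat) (a0 : int) (s : seq nat) : Prop :=
  [/\ (1 <= size s)%N, all (leq 1) s, (2 <= last 0%N s)%N
    & x = cfrac a0%:~R s].

(* A non-integral [x] has exactly one such expansion (see
   [cf_expansion_exists] and [cf_expansion_unique]); the default value [[::]]
   is only used when [x] is an integer. *)
Definition partial_quotients (x : rat) : seq nat :=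
  xget [::] [set s | exists a0 : int, is_cf_expansion x a0 s]%classic.

Definition max_partial_quotient (a b : int) : nat :=
  \max_(k <- partial_quotients (a%:~R / b%:~R)) k.

Lemma cfrac_gt1 (b : nat) (s : seq nat) :
  (0 < b)%N -> all (leq 1) s -> (2 <= last b s)%N -> 1 < cfrac b%:R s.
Proof.
elim: s b => [|a s IH] b /= b0; first by move=> _ b2; rewrite ltr1n.
case/andP=> a0 s0 l; have h := IH _ a0 s0 l.
have h0 : 0 < (cfrac a%:R s)^-1 by rewrite invr_gt0 (lt_trans ltr01 h).
by rewrite (le_lt_trans (y := b%:R)) ?ler1n // ltrDl.
Qed.

Lemma cf_expansion_floor (x : rat) (a0 : int) (s : seq nat) :
  is_cf_expansion x a0 s -> a0%:~R < x < a0%:~R + 1.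
Proof.
case; case: s => //= a s _ /andP[a_gt0 s0] l ->.
have h : 1 < cfrac a%:R s by apply: cfrac_gt1.
have h0 := lt_trans ltr01 h.
by rewrite ltrDl invr_gt0 h0 ltrD2l invf_lt1.
Qed.

Lemma cf_expansion_unique (x : rat) (a0 b0 : int) (s t : seq nat) :
  is_cf_expansion x a0 s -> is_cf_expansion x b0 t -> a0 = b0 /\ s = t.
Proof.
elim: s x a0 b0 t => [|a s IH] x a0 b0 t hs ht; first by case: hs.
have eab : a0 = b0.
  have /andP[l1 u1] := cf_expansion_floor hs.
  have /andP[l2 u2] := cf_expansion_floor ht.
  have -> : a0 = Num.floor x.
    by apply/esym/floor_def; rewrite (ltW l1) intrD.
  by apply: floor_def; rewrite (ltW l2) intrD.
subst b0; split=> //.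
case: hs => _ /= /andP[a_gt0 s0] ls xs.
case: t ht => [|b t] [] //= _ /andP[b_gt0 t0] lt xt.
have {xs xt} E : cfrac a%:R s = cfrac b%:R t.
  by apply: invr_inj; apply: (addrI a0%:~R); rewrite -xs -xt.
case: s IH s0 ls E => [|a' s] IH s0 ls E.
  case: t t0 lt E => [|b' t] t0 lt E.
    by move: E => /= /eqP; rewrite eqr_nat => /eqP ->.
  have := cf_expansion_floor (x := cfrac b%:R (b' :: t)) (a0 := b%:Z)
            (s := b' :: t) (And4 isT t0 lt erefl).
  rewrite -E /= => /andP[]; rewrite -[b%:~R]/(b%:R : rat) ltr_nat => h.
  by rewrite natr1 ltr_nat ltnS leqNgt h.
case: t t0 lt E => [|b' t] t0 lt E.
  have := cf_expansion_floor (x := cfrac a%:R (a' :: s)) (a0 := a%:Z)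
            (s := a' :: s) (And4 isT s0 ls erefl).
  rewrite E /= => /andP[]; rewrite -[a%:~R]/(a%:R : rat) ltr_nat => h.
  by rewrite natr1 ltr_nat ltnS leqNgt h.
by have [|[->] ->] := IH (cfrac a%:R (a' :: s)) a%:Z b%:Z (b' :: t)
  (And4 isT s0 ls erefl).
Qed.

Lemma cf_expansion_exists (p : int) (q : nat) :
  (1 < q)%N -> coprimez p q%:Z ->
  exists a0 s, is_cf_expansion (p%:~R / q%:R) a0 s.
Proof.
elim/ltn_ind: q p => q IH p q1 cpq.
have q0 : (q%:R : rat) != 0 by rewrite pnatr_eq0; case: (q) q1.
have qZ0 : q%:Z != 0 by case: (q) q1.
have /andP[r0 rq] : (0 <= (p %% q%:Z)%Z) && ((p %% q%:Z)%Z < q%:Z).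
  by rewrite modz_ge0 // ltz_pmod // ltz_nat ltnW.
have cr : coprimez (p %% q%:Z)%Z q%:Z.
  by rewrite /coprimez gcdz_modl.
have Ep := divz_eq p q%:Z.
set k := (p %/ q%:Z)%Z in Ep *.
case: (p %% q%:Z)%Z r0 rq cr Ep => // r _; rewrite ltz_nat => rq cr Ep.
have Ex : (p%:~R / q%:R : rat) = k%:~R + (q%:R / r%:R)^-1.
  by rewrite Ep intrD intrM mulrDl mulfK // invf_div.
have cr' : coprimez q%:Z r%:Z by rewrite coprimez_sym.
case: (leqP r 1) => [|r1].
  case: r rq cr Ep Ex cr' => [|[|//]] rq cr Ep Ex cr' _.
    by move: cr; rewrite /coprimez gcd0z /= => /eqP[] E; rewrite E in q1.
  exists k, [:: q]; split=> //=; first by rewrite ltnW.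
  by rewrite Ex divr1.
have [a0 [s hs]] := IH r rq q%:Z r1 cr'.
have /andP[_ a0q] := cf_expansion_floor hs.
have a0_gt0 : 0 < a0.
  have : (1 : rat) < (a0 + 1)%:~R.
    rewrite intrD; apply: lt_trans a0q.
    by rewrite ltr_pdivlMr ?ltr0n ?(ltnW r1) // mul1r ltr_nat.
  by rewrite intrD ltrDr ltr0z.
case: a0 a0_gt0 hs {a0q} => // a a_gt0 [hs1 hs2 hs3 hs4].
exists k, (a :: s); split=> //=; first by rewrite -ltz_nat a_gt0.
  by case: (s) hs1 hs3.
by rewrite Ex hs4.
Qed.

(* Main.v *)
Require Import Defs.
From mathcomp Require Import all_boot all_order all_algebra.
From mathcomp Require Import complex ring lra zify.
From mathcomp Require Import all_classical all_reals all_analysis.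

Import Order.TTheory GRing.Theory Num.Theory.

Local Open Scope ring_scope.

(** Write c = N q2, so that N is the c' of the theorem, and split the index j
    as j = m q2 + r with 0 <= r < q2.  Since chi2 has period q2, the sum
    becomes a combination, over the finitely many pairs (r, n) and with
    coefficients depending on the characters alone, of the sums
<<
      sum_(m < N) B1 (m / N + r / c) * B1 (a m / N + y),
>>
    where y depends on r and n ([newform_dedekind_sum_split]); r = 0 drops out
    since chi2 0 = 0.  For 0 < r < q2 the first factor is an
    affine function of m of bounded variation, so Abel summation
    ([B1_weighted_sum_le]) reduces everything to a bound, uniform in M <= N
    and in y, for sum_(m < M) B1 (a m / N + y).

    As B1 is the odd part of the right-continuous sawtooth
    saw x = x - floor x - 1/2, it suffices to treat saw.  There the bound
    follows the Euclidean algorithm.  Counting by rows instead of by columns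
    the lattice points under the line of slope al and intercept y relates the
    floor sum of slope al to one of slope 1 / al
    ([floor_sum_reciprocity]).  The quadratic terms almost cancel, and the
    sawtooth sum changes by at most (1 + 1 / al) / 2 ([saw_sum_step]).  Since
    saw has period 1, only the fractional part of 1 / al matters afterwards,
    and 1 / al is at most one more than the corresponding partial quotient;
    moreover the bound M <= q on the length of the sum becomes K <= r for the
    next pair of the Euclidean algorithm.  Iterating, the sawtooth sum is at
    most 1/2 + 3/2 times the sum of the partial quotients
    ([saw_sum_cfrac]).

    The number of partial quotients is O(log N), because the denominators grow
    geometrically ([cfrac_size]).  This gives O(D log N); since N >= q1 >= 2,
    the factor log N is at most log^2 N / log 2. *)

(** * Sawtooth sums and reciprocity *)

Definition saw {R : realType} (x : R) : R := x - (Num.floor x)%:~R - 2^-1.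

Lemma saw_addz {R : realType} (x : R) (k : int) : saw (x + k%:~R) = saw x.
Proof.
rewrite /saw floorDrz ?intr_int // intrKfloor intrD; ring.
Qed.

Lemma saw_bound {R : realType} (x : R) : `|saw x| <= 2^-1.
Proof.
rewrite /saw; have := floor_itv x; rewrite intrD => /andP[h1 h2].
by rewrite ler_norml; apply/andP; split; lra.
Qed.

(** This makes B1 accessible without treating the integers separately: on them
    the two values of the sawtooth cancel. *)
Lemma B1_saw {R : realType} (x : R) : B1 x = 2^-1 * (saw x - saw (- x)).
Proof.
rewrite /B1 /saw; case: ifPn => hx.
  by rewrite floorN // !floorK // intrN floorK //; ring.
have -> : Num.floor (- x) = - Num.floor x - 1.
  by rewrite floorNceil opprK ceil_floor hx opprD.
by rewrite !intrD !intrN; field.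
Qed.

(** The floor of x as the number of positive integers up to x: the form in
    which lattice points below a line get counted, column by column or row by
    row. *)
Lemma count_floor {R : realType} (K : nat) (x : R) :
  0 <= x -> x < K%:R + 1 ->
  \sum_(0 <= k < K) (k.+1%:R <= x)%R%:R = (Num.floor x)%:~R :> R.
Proof.
move=> x0; elim: K => [|K IH] hx.
  rewrite big_nil (@floor_def _ _ 0) // x0 /=; move: hx; rewrite add0r; lra.
rewrite big_nat_recr //=; case: (leP (K.+1%:R : R) x) => hK.
  rewrite (@floor_def _ _ K.+1%:Z); last by rewrite intrD /= hK.
  rewrite (eq_big_nat _ _ (F2 := fun=> 1)).
    by rewrite big_const_nat subn0 iter_addr_0 natr1.
  move=> k /andP[_ hk]; rewrite (le_trans _ hK) //.
  by rewrite ler_nat; lia.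
by rewrite IH ?addr0 // natr1.
Qed.

(** Both sides count the points (m, k) with 0 <= m <= M, k >= 1 and
    k <= al m + y.  Here K is the height of the last column.  The row at height
    k consists of the m >= (k - y) / al; after reversing the order of the rows
    and reading each of them from right to left, its size is again a floor of
    an affine function, of slope 1 / al. *)
Lemma floor_sum_reciprocity {R : realType} (al y : R) (M K : nat) :
  0 < al -> 0 <= y -> y < 1 ->
  K%:R <= al * M%:R + y -> al * M%:R + y < K%:R + 1 ->
  \sum_(0 <= m < M.+1) (Num.floor (al * m%:R + y))%:~R
  = K%:R * M.+1%:R
    + \sum_(0 <= k < K) (Num.floor (al^-1 * k%:R + al^-1 * (y - K%:R)))%:~R :> R.
Proof.
move=> al0 y0 y1 hK1 hK2.
have al_n0 : al != 0 by rewrite gt_eqF.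
rewrite (eq_big_nat _ _ (F2 := fun m =>
    \sum_(0 <= k < K) (k.+1%:R <= al * m%:R + y)%R%:R)); last first.
  move=> m /andP[_ hm]; rewrite count_floor //.
    by rewrite addr_ge0 // mulr_ge0 // ltW.
  apply: le_lt_trans hK2; rewrite lerD2r ler_pM2l // ler_nat; lia.
rewrite exchange_big_nat /=.
rewrite (@big_nat_rev _ _ _ 0 K) /= add0n.
rewrite (eq_big_nat _ _ (F2 := fun k => M.+1%:R +
   (Num.floor (al^-1 * k%:R + al^-1 * (y - K%:R)))%:~R)); last first.
  move=> k /andP[_ hk].
  (* The row at height K - k. *)
  have -> : (K - k.+1).+1 = (K - k)%N by lia.
  have hkK : (k%:R + 1 <= K%:R :> R) by rewrite natr1 ler_nat.
  rewrite -[M.+1%:R]/(M.+1%:Z%:~R) -intrD -[M.+1%:Z](@intrKfloor R).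
  rewrite -floorDzr ?intr_int //.
  set x := M.+1%:Z%:~R + _.
  have Ex : al * x = al * M%:R + al + k%:R + y - K%:R.
    by rewrite /x -[M.+1%:Z%:~R]/(M.+1%:R) -natr1; field.
  have k0 : 0 <= k%:R :> R by [].
  rewrite big_nat_rev /= add0n -(@count_floor _ M.+1).
  - apply: eq_big_nat => m /andP[_ hm]; congr ((nat_of_bool _)%:R).
    rewrite -[RHS](ler_pM2l al0) Ex !natrB ?subSS -?natr1; [|lia|lia].
    by apply/idP/idP => ?; lra.
  - rewrite -(pmulr_rge0 _ al0) Ex; lra.
  - rewrite -(ltr_pM2l al0) Ex -natr1; lra.
rewrite big_split /=; congr (_ + _).
by rewrite big_const_nat subn0 iter_addr_0 [RHS]mulr_natl.
Qed.

Lemma sum_natr {R : realType} (n : nat) :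
  \sum_(0 <= m < n) m%:R = n%:R * (n%:R - 1) / 2 :> R.
Proof.
elim: n => [|n IH]; first by rewrite big_nil; ring.
by rewrite big_nat_recr //= IH -natr1; field.
Qed.

Lemma sum_saw {R : realType} (al y : R) (n : nat) :
  \sum_(0 <= m < n) saw (al * m%:R + y) =
  al * (n%:R * (n%:R - 1) / 2) + n%:R * (y - 2^-1)
  - \sum_(0 <= m < n) (Num.floor (al * m%:R + y))%:~R.
Proof.
rewrite -sum_natr mulr_sumr.
have -> : n%:R * (y - 2^-1) = \sum_(0 <= m < n) (y - 2^-1).
  by rewrite big_const_nat subn0 iter_addr_0 mulr_natl.
rewrite -big_split -sumrB /=; apply: eq_bigr => m _; rewrite /saw; ring.
Qed.

(** Substituting floor x = x - 1/2 - saw x in the reciprocity of floor sums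
    leaves a quadratic polynomial in M and K.  With z the fractional part of
    al M + y it factors as (al + z - y) (z + y - 1) / (2 al), which is bounded
    because y and z lie in [0, 1). *)
Lemma saw_sum_step {R : realType} (al y : R) (M K : nat) :
  0 < al -> 0 <= y -> y < 1 ->
  K%:R <= al * M%:R + y -> al * M%:R + y < K%:R + 1 ->
  `|\sum_(0 <= m < M.+1) saw (al * m%:R + y)|
  <= (1 + al^-1) / 2
     + `|\sum_(0 <= k < K) saw (al^-1 * k%:R + al^-1 * (y - K%:R))|.
Proof.
move=> al0 y0 y1 hK1 hK2.
set T := \sum_(0 <= k < K) _.
set z := al * M%:R + y - K%:R.
have -> : \sum_(0 <= m < M.+1) saw (al * m%:R + y)
    = al^-1 / 2 * ((al + z - y) * (z + y - 1)) + T.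
  rewrite /T sum_saw (floor_sum_reciprocity al y M K) // sum_saw /z.
  by field; rewrite gt_eqF.
apply: le_trans (ler_normD _ _) _; rewrite lerD2r.
rewrite !normrM ger0_norm; last by rewrite invr_ge0 ltW.
rewrite (ger0_norm (ltW _)) //.
have h1 : `|al + z - y| <= al + 1.
  by rewrite ler_norml; apply/andP; rewrite /z; split; lra.
have h2 : `|z + y - 1| <= 1.
  by rewrite ler_norml; apply/andP; rewrite /z; split; lra.
have -> : (1 + al^-1) / 2 = al^-1 / 2 * ((al + 1) * 1).
  by field; rewrite gt_eqF.
apply: ler_wpM2l; first by rewrite mulr_ge0 // invr_ge0 ltW.
exact: ler_pM.
Qed.

(** * Descent along the continued fraction *)

Lemma cfrac_itv (b : nat) (s : seq nat) :
  all (leq 1) s -> b%:R <= cfrac b%:R s <= b%:R + 1.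
Proof.
case: s => [|a s] /=; first by rewrite lexx lerDl ler01.
elim: s a b => [|a' s IH] a b /= /andP[a1 hs].
  have h : 1 <= a%:R :> rat by rewrite ler1n.
  by rewrite lerDl invr_ge0 ler0n lerD2l invf_le1 // (lt_le_trans ltr01).
have /andP[h _] := IH a' a hs.
have {}h : 1 <= a%:R + (cfrac a'%:R s)^-1.
  by apply: le_trans h; rewrite ler1n.
have h0 := lt_le_trans ltr01 h.
by rewrite lerDl invr_ge0 (ltW h0) lerD2l invf_le1.
Qed.

(** Removing the first partial quotient is one division step: r is the remainder
    of p by q, except that r = q is possible, which happens when the expansion
    ends in 1. *)
Lemma cfrac_step (a0 p : int) (q a1 : nat) (s : seq nat) :
  (0 < q)%N -> all (leq 1) (a1 :: s) ->
  p%:~R / q%:R = cfrac a0%:~R (a1 :: s) ->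
  exists r : nat, [/\ p = a0 * q%:Z + r%:Z, (0 < r <= q)%N
                    & (q%:Z%:~R / r%:R : rat) = cfrac a1%:~R s].
Proof.
move=> q0 /= /andP[a10 hs] E.
have /andP[h _] := cfrac_itv a1 s hs.
move: E h; rewrite -[a1%:~R]/(a1%:R : rat); set x := cfrac _ s => E h.
have x1 : 1 <= x by apply: le_trans h; rewrite ler1n.
have x0 := lt_le_trans ltr01 x1.
have qr0 : 0 < q%:R :> rat by rewrite ltr0n.
have qn0 : (q%:R : rat) != 0 by rewrite gt_eqF.
have Er : (p - a0 * q%:Z)%:~R = q%:R / x :> rat.
  rewrite intrD intrN intrM -[q%:~R]/(q%:R : rat).
  have -> : p%:~R = (a0%:~R + x^-1) * q%:R :> rat by rewrite -E divfK.
  ring.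
have r0 : 0 < p - a0 * q%:Z by rewrite -(ltr0z rat) Er divr_gt0.
case Ed : (p - a0 * q%:Z) r0 => [r|//] r0.
move: Er; rewrite Ed -[r%:~R]/(r%:R : rat) => Er.
exists r; split.
- by rewrite -Ed; ring.
- apply/andP; split=> //.
  by rewrite -(ler_nat rat) Er ler_pdivrMr // ler_peMr // ltW.
- by rewrite Er -[q%:~R]/(q%:R : rat); field; rewrite qn0 gt_eqF.
Qed.

(** Each step of the expansion replaces the pair (p, q) by (q, r) and costs
    (1 + q / r) / 2 <= (a1 + 2) / 2 <= 3/2 a1.  The range M <= q is what makes
    the induction end well: the new length K is at most r, so that when the
    expansion is exhausted, q = 1 and at most one term is left. *)
Lemma saw_sum_cfrac {R : realType} (s : seq nat) (a0 p : int) (q : nat) :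
  (0 < q)%N -> coprimez p q%:Z -> all (leq 1) s ->
  p%:~R / q%:R = cfrac a0%:~R s ->
  forall (M : nat) (y : R), (M <= q)%N ->
  `|\sum_(0 <= m < M) saw (p%:~R / q%:R * m%:R + y)|
  <= 2^-1 + 3 / 2 * (\sum_(k <- s) k)%:R.
Proof.
elim: s a0 p q => [|a1 s IH] a0 p q q0 cpq hs E M y hM.
  have q1 : q = 1%N.
    have Ep : p = a0 * q%:Z.
      apply: (@intr_inj rat); rewrite intrM -[q%:~R]/(q%:R : rat).
      by rewrite -[a0%:~R]E divfK // pnatr_eq0 -lt0n.
    by move: cpq; rewrite Ep /coprimez gcdzC gcdzMl => /eqP[].
  rewrite big_nil mulr0 addr0.
  move: hM; rewrite q1; case: M => [|[|//]] _.
    by rewrite big_nil normr0 invr_ge0.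
  by rewrite big_nat1 saw_bound.
have [r [Ep /andP[r0 rq] Er]] := cfrac_step _ _ _ _ _ q0 hs E.
case: M hM => [|M] hM.
  by rewrite big_nil normr0 addr_ge0 ?invr_ge0 ?mulr_ge0 ?invr_ge0.
have /andP[a10 hs'] : (1 <= a1)%N && all (leq 1) s := hs.
have qR : 0 < q%:R :> R by rewrite ltr0n.
have rR : 0 < r%:R :> R by rewrite ltr0n.
set al : R := r%:R / q%:R.
have al0 : 0 < al by rewrite divr_gt0.
have /andP[f1 f2] := floor_itv y.
set y1 := y - (Num.floor y)%:~R.
have y10 : 0 <= y1 by rewrite subr_ge0.
have y11 : y1 < 1 by rewrite ltrBlDl -intrD1.
have -> : \sum_(0 <= m < M.+1) saw (p%:~R / q%:R * m%:R + y)
        = \sum_(0 <= m < M.+1) saw (al * m%:R + y1).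
  apply: eq_bigr => m _.
  (* By periodicity, a0 m and the floor of y may be dropped. *)
  rewrite -(saw_addz (_ + y1) (a0 * m%:Z + Num.floor y)); congr saw.
  rewrite Ep !intrD !intrM /al /y1 -[q%:~R]/(q%:R : R) -[r%:~R]/(r%:R : R).
  by rewrite -[m%:~R]/(m%:R : R); field; rewrite gt_eqF.
have z0 : 0 <= al * M%:R + y1 by rewrite addr_ge0 // mulr_ge0 // ltW.
have [K /andP[K1 K2]] : exists K : nat,
    K%:R <= al * M%:R + y1 < K%:R + 1.
  by exists (Num.trunc (al * M%:R + y1)); rewrite natr1 truncn_itv.
have Kr : (K <= r)%N.
  (* The points m <= q - 1 satisfy al m + y1 <= r - al + y1 < r + 1. *)
  have MR : M%:R + 1 <= q%:R :> R by rewrite natr1 ler_nat.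
  have : K%:R < r%:R + 1 :> R.
    have : al * M%:R <= r%:R - al.
      have -> : r%:R - al = al * (q%:R - 1) by rewrite /al; field; rewrite gt_eqF.
      by rewrite ler_pM2l //; lra.
    lra.
  by rewrite natr1 ltr_nat.
apply: le_trans (saw_sum_step al y1 M K al0 y10 y11 K1 K2) _.
have cqr : coprimez q%:Z r%:Z.
  by move: cpq; rewrite Ep /coprimez gcdzC gcdzMDl.
have := IH a1%:Z q%:Z r r0 cqr hs' Er K (al^-1 * (y1 - K%:R)) Kr.
rewrite -[q%:~R]/(q%:R : R).
have -> : q%:R / r%:R = al^-1 by rewrite /al invf_div.
move=> h; apply: le_trans (lerD (lexx _) h) _.
rewrite big_cons natrD.
have ub : al^-1 <= a1%:R + 1.
  have Er' : q%:R / r%:R = cfrac a1%:R s :> rat := Er.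
  have /andP[_] := cfrac_itv a1 s hs'; rewrite -Er'.
  rewrite ler_pdivrMr ?ltr0n // natr1 -natrM ler_nat => hq.
  by rewrite /al invf_div ler_pdivrMr // natr1 -natrM ler_nat.
have a1R : 1 <= a1%:R :> R by rewrite ler1n.
lra.
Qed.

(** The product of two consecutive denominators q and r at least doubles at each
    step: if q = a1 r + t with t <= r, then q >= 2 t and q r >= 2 r t. *)
Lemma cfrac_size (s : seq nat) (a0 p : int) (q : nat) :
  (0 < q)%N -> all (leq 1) s -> p%:~R / q%:R = cfrac a0%:~R s ->
  (2 ^ size s <= 2 * q ^ 2)%N.
Proof.
case: s => [|a1 s] q0; first by move=> _ _ /=; rewrite muln_gt0 expn_gt0 q0.
move=> hs E.
have [r [_ /andP[r0 rq] Er]] := cfrac_step _ _ _ _ _ q0 hs E.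
(* The product of consecutive denominators is the quantity that doubles. *)
suff : (2 ^ (size s).+1 <= 2 * (q * r))%N.
  by move=> h; apply: leq_trans h _; rewrite leq_mul2l /= leq_mul2l rq orbT.
clear E q0; move: a1 hs q r r0 rq Er.
elim: s => [|a2 s IH] a1 hs q r r0 rq Er.
  by rewrite /= expn1 leq_pmulr // muln_gt0 (leq_trans r0 rq).
have /andP[a10 hs'] : (1 <= a1)%N && all (leq 1) (a2 :: s) := hs.
have [t [Eq /andP[t0 tr] Et]] := cfrac_step _ _ _ _ _ r0 hs' Er.
have h := IH a2 hs' r t t0 tr Et.
have {}Eq : q = (a1 * r + t)%N by lia.
have tq : (2 * t <= q)%N.
  by rewrite Eq mul2n -addnn leq_add2r (leq_trans tr) // leq_pmull.
rewrite expnS leq_mul2l /= (leq_trans h) // mulnCA mulnC.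
by rewrite leq_mul2r tq orbT.
Qed.

(** * Uniform bounds for sums of B1 *)

Lemma max_partial_quotientP (a : int) (N : nat) :
  (1 < N)%N -> coprimez a N%:Z ->
  exists (a0 : int) (s : seq nat),
    is_cf_expansion (a%:~R / N%:R) a0 s /\
    (\sum_(k <- s) k <= size s * max_partial_quotient a N%:Z)%N.
Proof.
move=> N1 caN.
have [b0 [t ht]] := cf_expansion_exists N1 caN.
set D := max_partial_quotient a N%:Z.
have [a0 hs] : exists a0, is_cf_expansion (a%:~R / N%:R) a0
    (partial_quotients (a%:~R / N%:Z%:~R)).
  apply: (@xgetPex _ [::] [set s | exists a0 : int,
    is_cf_expansion (a%:~R / N%:R) a0 s]%classic).
  by exists t, b0.
exists a0, (partial_quotients (a%:~R / N%:Z%:~R)); split=> //.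
rewrite mulnC -sum1_size big_distrr /= big_seq [leqRHS]big_seq.
by apply: leq_sum => k hk; rewrite muln1 (leq_bigmax_seq (F := id) k).
Qed.

(** With n partial quotients, 1/2 + 3/2 n D <= 2 n D, and
    n log 2 <= log 2 + 2 log N <= 3 log N. *)
Lemma saw_sum_le_ln {R : realType} (a : int) (N M : nat) (y : R) :
  (1 < N)%N -> coprimez a N%:Z -> (M <= N)%N ->
  `|\sum_(0 <= m < M) saw (a%:~R / N%:R * m%:R + y)|
  <= 6 / ln 2 * (max_partial_quotient a N%:Z)%:R * ln N%:R.
Proof.
move=> N1 caN hM.
have [a0 [s [[s1 hs _ E] sumD]]] := max_partial_quotientP a N N1 caN.
set D := max_partial_quotient a N%:Z in sumD *.
apply: le_trans (saw_sum_cfrac s a0 a N (ltnW N1) caN hs E M y hM) _.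
have ln2 : 0 < ln 2 :> R by rewrite ln_gt0 // ltr1n.
have nD1 : (1 <= size s * D)%N.
  apply: leq_trans sumD; case: (s) s1 hs => //= k s' _ /andP[k1 _].
  by rewrite big_cons (leq_trans k1) ?leq_addr.
have h1 : (\sum_(k <- s) k)%:R <= (size s)%:R * D%:R :> R.
  by rewrite -natrM ler_nat.
have h2 : 1 <= (size s)%:R * D%:R :> R by rewrite -natrM ler1n.
have h3 : (size s)%:R * ln 2 <= 3 * ln N%:R :> R.
  have N2 : ln 2 <= ln N%:R :> R by rewrite ler_ln ?posrE ?ltr0n ?ler_nat ?(ltnW N1).
  have := cfrac_size s a0 a N (ltnW N1) hs E.
  rewrite -(ler_nat R) natrM !natrX => h.
  have : ln (2 ^+ size s) <= ln (2 * N%:R ^+ 2) :> R.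
    by rewrite ler_ln ?posrE ?mulr_gt0 ?exprn_gt0 ?ltr0n ?(ltnW N1).
  rewrite lnM ?posrE ?exprn_gt0 ?ltr0n ?(ltnW N1) //.
  rewrite !lnXn ?ltr0n ?(ltnW N1) // -[ln N%:R *+ 2]mulr_natl -[ln 2 *+ _]mulr_natl.
  lra.
have h4 : (size s)%:R <= 3 / ln 2 * ln N%:R :> R.
  by rewrite mulrAC ler_pdivlMr.
have h5 : (size s)%:R * D%:R <= 3 / ln 2 * ln N%:R * D%:R :> R.
  by rewrite ler_wpM2r.
have -> : 6 / ln 2 * D%:R * ln N%:R = 2 * (3 / ln 2 * ln N%:R * D%:R) :> R.
  ring.
lra.
Qed.

(** The odd part of saw costs nothing: reversing the order of summation turns
    the sum of saw (- x) along a progression into a sum of saw along a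
    progression with the same step, for another offset. *)
Lemma B1_sum_le {R : realType} (al B : R) (M : nat) :
  (forall y, `|\sum_(0 <= m < M) saw (al * m%:R + y)| <= B) ->
  forall y, `|\sum_(0 <= m < M) B1 (al * m%:R + y)| <= B.
Proof.
move=> hB y.
under eq_bigr do rewrite B1_saw.
rewrite -mulr_sumr sumrB [X in _ - X]big_nat_rev /= add0n.
have -> : \sum_(0 <= m < M) saw (- (al * (M - m.+1)%:R + y))
        = \sum_(0 <= m < M) saw (al * m%:R + (al * (1 - M%:R) - y)).
  apply: eq_big_nat => m /andP[_ hm]; congr saw.
  by rewrite natrB // -natr1; ring.
have h1 := hB y; have h2 := hB (al * (1 - M%:R) - y).
rewrite normrM ger0_norm ?invr_ge0 //.
have := ler_normB (\sum_(0 <= m < M) saw (al * m%:R + y))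
  (\sum_(0 <= m < M) saw (al * m%:R + (al * (1 - M%:R) - y))).
lra.
Qed.

Lemma abel_summation {R : comPzRingType} (u g : nat -> R) (n : nat) :
  \sum_(0 <= m < n) u m * g m
  = u n * (\sum_(0 <= i < n) g i)
    - \sum_(0 <= m < n) (u m.+1 - u m) * (\sum_(0 <= i < m.+1) g i).
Proof.
elim: n => [|n IH]; first by rewrite !big_nil; ring.
pose G k := \sum_(0 <= i < k) g i.
have GS : G n.+1 = G n + g n by rewrite /G big_nat_recr.
rewrite big_nat_recr //= IH.
rewrite -[RHS]/(u n.+1 * G n.+1 - \sum_(0 <= m < n.+1) (u m.+1 - u m) * G m.+1).
rewrite [in RHS]big_nat_recr //= GS /G; ring.
Qed.

(** For 0 < t < 1 / N the arguments m / N + t stay inside (0, 1), so the weights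
    are affine in m: extended to m = N the last one is at most 3/2, and the
    total variation is 1. *)
Lemma B1_weighted_sum_le {R : realType} (N : nat) (t B : R) (g : nat -> R) :
  (0 < N)%N -> 0 < t -> t < N%:R^-1 ->
  (forall M, (M <= N)%N -> `|\sum_(0 <= m < M) g m| <= B) ->
  `|\sum_(0 <= m < N) B1 (m%:R / N%:R + t) * g m| <= 5 / 2 * B.
Proof.
move=> N0 t0 t1 hB.
have NR : 0 < N%:R :> R by rewrite ltr0n.
pose u m : R := m%:R / N%:R + t - 2^-1.
have Nn : N%:R != 0 :> R by rewrite gt_eqF.
have -> : \sum_(0 <= m < N) B1 (m%:R / N%:R + t) * g m
        = \sum_(0 <= m < N) u m * g m.
  apply: eq_big_nat => m /andP[_ hm]; congr (_ * _).
  have x0 : 0 < m%:R / N%:R + t.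
    by rewrite ltr_wpDl // divr_ge0.
  have x1 : m%:R / N%:R + t < 1.
    apply: (@lt_le_trans _ _ (m%:R / N%:R + N%:R^-1)); first by rewrite ltrD2l.
    by rewrite -[X in _ + X]mul1r -mulrDl natr1 ler_pdivrMr // mul1r ler_nat.
  have fl : Num.floor (m%:R / N%:R + t) = 0.
    by apply: floor_def; rewrite (ltW x0) add0r.
  by rewrite /B1 intrEfloor fl eq_sym gt_eqF // subr0.
rewrite abel_summation.
apply: le_trans (ler_normB _ _) _.
have B0 : 0 <= B by apply: le_trans (hB 0%N _).
have tN : t <= 1 by rewrite (le_trans (ltW t1)) // invf_le1 // ler1n.
have h1 : `|u N * (\sum_(0 <= i < N) g i)| <= 3 / 2 * B.
  rewrite normrM; apply: ler_pM => //; last exact: hB.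
  by rewrite /u divff // ger0_norm; lra.
have h2 : `|\sum_(0 <= m < N) (u m.+1 - u m) * (\sum_(0 <= i < m.+1) g i)| <= B.
  apply: le_trans (ler_norm_sum _ _ _) _.
  apply: (@le_trans _ _ (\sum_(0 <= m < N) N%:R^-1 * B)).
    rewrite big_seq [leRHS]big_seq; apply: ler_sum => m.
    rewrite mem_index_iota => /andP[_ hm].
    have -> : u m.+1 - u m = N%:R^-1 by rewrite /u -natr1; field.
    rewrite normrM ger0_norm ?invr_ge0 // ler_wpM2l ?invr_ge0 //; exact: hB.
  by rewrite big_const_nat subn0 iter_addr_0 -[(_ * B) *+ N]mulr_natl mulrA divff // mul1r.
lra.
Qed.

(** * The newform Dedekind sum *)

(** Grouping j by its residue r modulo q2 isolates the values of chi2, and the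
    argument a j / c then runs over a progression of step a / N, with N the
    complementary factor of the modulus. *)
Lemma newform_dedekind_sum_split {R : realType} (q1 q2 N : nat)
    (chi1 : dirichlet_character R q1) (chi2 : dirichlet_character R q2) (a : int) :
  (0 < q2)%N -> (0 < N)%N ->
  newform_dedekind_sum chi1 chi2 a (N * q2)
  = \sum_(0 <= r < q2) \sum_(0 <= n < q1) (chi2 r%:Z)^* * (chi1 n%:Z)^*
    * (\sum_(0 <= m < N) B1 (m%:R / N%:R + r%:R / (N * q2)%:R)
        * B1 (a%:~R / N%:R * m%:R
              + (n%:R / q1%:R + a%:~R * r%:R / (N * q2)%:R)))%:C%C.
Proof.
move=> q20 N0; rewrite /newform_dedekind_sum.
pose F j n := (chi2 j%:Z)^* * (chi1 n%:Z)^* * (B1 (j%:R / (N * q2)%:R : R))%:C%C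
    * (B1 (n%:R / q1%:R + a%:~R * j%:R / (N * q2)%:R : R))%:C%C.
rewrite (eq_bigr (fun j : 'I_(N * q2) => \sum_(0 <= n < q1) F j n)); last first.
  by move=> j _; rewrite big_mkord.
rewrite -(big_mkord xpredT (fun j => \sum_(0 <= n < q1) F j n)) big_nat_mul.
rewrite (eq_bigr (fun m => \sum_(0 <= r < q2) \sum_(0 <= n < q1)
    F (r + m * q2)%N n)); last first.
  by move=> m _; rewrite -{1}[(m * q2)%N]add0n big_addn mulSn addnK.
rewrite exchange_big_nat /=; apply: eq_bigr => r _.
rewrite exchange_big_nat /=; apply: eq_bigr => n _.
rewrite rmorph_sum mulr_sumr; apply: eq_bigr => m _.
have nN : N%:R != 0 :> R by rewrite pnatr_eq0 -lt0n.
have nq : q2%:R != 0 :> R by rewrite pnatr_eq0 -lt0n.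
rewrite rmorphM /F mulrA; congr (_ * _ * _%:C%C * _%:C%C).
- congr (_^*); apply: dchar_periodic.
  by rewrite PoszD PoszM addrC modzMDl.
- by congr B1; rewrite natrD !natrM; field; rewrite nN nq.
- congr B1; rewrite [RHS]addrCA; congr (_ + _).
  by rewrite natrD !natrM; field; rewrite nN nq.
Qed.

Lemma nontrivial_char_gt1 {R : realType} (q : nat)
    (chi : dirichlet_character R q) :
  (0 < q)%N -> nontrivial_char chi -> (1 < q)%N.
Proof.
case: q chi => [|[|q]] // chi _ [n [_ []]].
have chi1 : chi 1 != 0 by rewrite dchar_neq0.
have -> : chi n = chi 1 by apply: dchar_periodic; rewrite !modz1.
by apply: (mulfI chi1); rewrite mulr1 -dcharM mulr1.
Qed.

Lemma dchar0 {R : realType} (q : nat) (chi : dirichlet_character R q) :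
  (1 < q)%N -> chi 0 = 0.
Proof.
move=> q1; apply/eqP; rewrite -[_ == _]negbK dchar_neq0.
by rewrite /coprimez gcd0z eqz_nat /= gtn_eqF.
Qed.

Theorem theorem1p4 (R : realType) (q1 q2 : nat)
    (hq1 : (0 < q1)%N) (hq2 : (0 < q2)%N)
    (chi1 : dirichlet_character R q1) (chi2 : dirichlet_character R q2)
    (hprim1 : primitive_char chi1) (hprim2 : primitive_char chi2)
    (hnt1 : nontrivial_char chi1) (hnt2 : nontrivial_char chi2)
    (hparity : chi1 (-1) * chi2 (-1) = 1) :
  exists Q : R, forall (a : int) (c : nat),
    (1 <= c)%N -> (q1 * q2 %| c)%N -> coprimez a c%:Z ->
    let c' := (c %/ q2)%N in
    `|newform_dedekind_sum chi1 chi2 a c|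
      <= (Q * (max_partial_quotient a c'%:Z)%:R * ln (c'%:R : R) ^+ 2)%:C%C.
Proof.
have q1gt1 := nontrivial_char_gt1 _ chi1 hq1 hnt1.
have q2gt1 := nontrivial_char_gt1 _ chi2 hq2 hnt2.
have ln2 : 0 < ln 2 :> R by rewrite ln_gt0 // ltr1n.
pose W : R := \sum_(0 <= r < q2) \sum_(0 <= n < q1)
  Normc.normc (chi2 r%:Z) * Normc.normc (chi1 n%:Z).
exists (W * (15 / ln 2 ^+ 2)) => a c c1 dvc cac /=.
have [k Ec] := dvdnP dvc.
set N := (k * q1)%N.
have EcN : c = (N * q2)%N by rewrite Ec mulnA.
have -> : (c %/ q2)%N = N by rewrite EcN mulnK.
have N0 : (0 < N)%N by move: c1; rewrite EcN muln_gt0 => /andP[].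
have N1 : (1 < N)%N.
  by apply: (leq_trans q1gt1); rewrite dvdn_leq // dvdn_mull.
have caN : coprimez a N%:Z.
  by move: cac; rewrite EcN PoszM coprimezMr => /andP[].
set D := max_partial_quotient a N%:Z.
pose X : R := 6 / ln 2 * D%:R * ln N%:R.
have lnN : ln 2 <= ln N%:R :> R by rewrite ler_ln ?posrE ?ltr0n ?ler_nat.
(* One factor log N is traded for log^2 N / log 2. *)
have XB : 5 / 2 * X <= 15 / ln 2 ^+ 2 * D%:R * ln N%:R ^+ 2.
  have -> : 15 / ln 2 ^+ 2 * D%:R * ln N%:R ^+ 2
          = 5 / 2 * X * (ln N%:R / ln 2) by rewrite /X; field; rewrite gt_eqF.
  rewrite ler_peMr //; last by rewrite ler_pdivlMr // mul1r.
  rewrite /X !mulr_ge0 // ?invr_ge0 ?(ltW ln2) //.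
  exact: le_trans (ltW ln2) lnN.
have normE (z : R[i]) : `|z| = (Normc.normc z)%:C%C by case: z.
have normc_ge0 (z : R[i]) : 0 <= Normc.normc z by case: z => x y; exact: sqrtr_ge0.
have -> : W * (15 / ln 2 ^+ 2) * D%:R * ln N%:R ^+ 2
        = W * (15 / ln 2 ^+ 2 * D%:R * ln N%:R ^+ 2) by ring.
rewrite EcN newform_dedekind_sum_split // /W mulr_suml rmorph_sum /=.
apply: le_trans (ler_norm_sum _ _ _) _.
rewrite big_seq [leRHS]big_seq; apply: ler_sum => r.
rewrite mem_index_iota => /andP[_ hr].
rewrite mulr_suml rmorph_sum /=.
apply: le_trans (ler_norm_sum _ _ _) _; apply: ler_sum => n _.
rewrite !normrM !norm_conjC !normE -!rmorphM lecR.
have [-> | r0] := posnP r.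
  by rewrite dchar0 // Normc.normc0 !mul0r.
apply: ler_wpM2l; first by rewrite mulr_ge0 // normc_ge0.
apply: le_trans XB.
set A := \sum_(0 <= m < N) _.
have -> : Normc.normc A%:C%C = `|A|.
  by rewrite /= expr0n addr0 sqrtr_sqr.
apply: B1_weighted_sum_le => //.
- by rewrite divr_gt0 // ltr0n // muln_gt0 N0.
- rewrite natrM invfM mulrA ltr_pdivrMr ?ltr0n //.
  by rewrite mulrC ltr_pM2l ?ltr_nat // invr_gt0 ltr0n.
- move=> M hM; apply: B1_sum_le => y; exact: saw_sum_le_ln.
Qed.
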